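(* Let $P\in\mathcal{B}(\mathcal{H})$ be an idempotent and $J\in\mathcal{B}(\mathcal{H})$ a symmetry. Then $J\in\Delta_P$ if and only if $$J'=\sqrt{-1}\,J\,\bigl(2P_{(P+P^{*})^{+}}-I\bigr)\in\Gamma_P.$$
   Context: $\mathcal{H}$ is a separable complex Hilbert space and $\mathcal{B}(\mathcal{H})$ is the set of bounded linear operators on $\mathcal{H}$. An idempotent is $P\in\mathcal{B}(\mathcal{H})$ with $P^2=P$ (not necessarily self-adjoint). A symmetry is an operator $J$ with $J=J^*=J^{-1}$. Put $$\Gamma_P=\{J: J=J^*=J^{-1},\ JPJ=I-P\},\qquad \Delta_P=\{J: J=J^*=J^{-1},\ JPJ=I-P^*\}.$$ For self-adjoint $S$, $S^{+}=\frac{|S|+S}{2}$ is its positive part, where $|S|=(S^*S)^{1/2}$; for an operator $A$, $P_A$ is the orthogonal projection onto $\overline{R(A)}$, the closure of the range of $A$. So $P_{(P+P^* )^+}$ is the orthogonal projection onto the closure of the range of the positive part of $P+P^*$. *)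

(* Defs.v *)
From HB Require Import structures.
From mathcomp Require Import all_boot all_order all_algebra.
From mathcomp Require Import sesquilinear complex.
From mathcomp Require Import all_classical all_reals all_analysis.

Set Implicit Arguments.
Unset Strict Implicit.
Unset Printing Implicit Defensive.

Import Order.TTheory GRing.Theory Num.Theory.
Import numFieldNormedType.Exports.

Local Open Scope classical_set_scope.
Local Open Scope ring_scope.
Local Open Scope complex_scope.

(* [{dot H for _}] is linear in its first argument, conjugate-linear in the
   second one, and positive definite. *)
HB.mixin Record CompleteNormedModule_isHilbert (R : realType) H
    & CompleteNormedModule R[i] H := {
  inner : {dot H for @Num.conj R[i]} ;
  innerE : forall x : H, inner x x = `|x| ^+ 2
}.

#[short(type="hilbertType")]
HB.structure Definition Hilbert (R : realType) :=
  {H of CompleteNormedModule R[i] H & CompleteNormedModule_isHilbert R H}.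

Definition separable_space (T : topologicalType) :=
  exists2 D : set T, countable D & dense D.

Section BoundedOperators.
Variables (R : realType) (H : hilbertType R).

Definition bounded_op (f : H -> H) :=
  exists M : R, forall x, `|f x| <= M%:C * `|x|.

Definition bounded_linear : {pred H -> H} :=
  mem [set f : H -> H | linear f /\ bounded_op f].

Record bop := Bop {
  bop_fun :> H -> H ;
  bop_subproof : bop_fun \in bounded_linear
}.

HB.instance Definition _ := [isSub for bop_fun].
HB.instance Definition _ := [Choice of bop by <:].

Lemma bopP (f : bop) : linear f /\ bounded_op f.
Proof. exact/set_mem/(bop_subproof f). Qed.

Lemma bopD (f : bop) x y : f (x + y) = f x + f y.
Proof. by have [lf _] := bopP f; have := lf 1 x y; rewrite !scale1r. Qed.

Lemma bounded_linear_submod : submod_closed bounded_linear.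
Proof.
split.
  apply/mem_set; split=> [a x y|].
    by rewrite /GRing.zero/= scaler0 addr0.
  by exists 0 => x; rewrite /GRing.zero/= normr0 mul0r.
move=> a f g /set_mem[lf [M fM]] /set_mem[lg [N gN]]; apply/mem_set; split.
  move=> b x y; rewrite -[LHS]/(a *: f (b *: x + y) + g (b *: x + y)).
  rewrite -[RHS]/(b *: (a *: f x + g x) + (a *: f y + g y)).
  by rewrite lf lg !scalerDr !scalerA (mulrC a b) addrACA.
have /complex_realP[r aE] := normr_real a.
exists (r * M + N) => x; rewrite -[(_ + _) x]/(a *: f x + g x).
apply: (le_trans (ler_normD _ _)); rewrite normrZ rmorphD rmorphM mulrDl.
by apply: lerD => //=; rewrite -aE -mulrA ler_wpM2l.
Qed.

HB.instance Definition _ :=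
  GRing.isSubmodClosed.Build R[i] (H -> H) bounded_linear bounded_linear_submod.
HB.instance Definition _ := [SubChoice_isSubLmodule of bop by <:].

Lemma bounded_linear_id : idfun \in bounded_linear.
Proof.
by apply/mem_set; split=> //; exists 1 => x; rewrite mul1r.
Qed.

Lemma bounded_linear_comp (f g : bop) : (f : H -> H) \o g \in bounded_linear.
Proof.
have [[lf [M fM]] [lg [N gN]]] := (bopP f, bopP g).
apply/mem_set; split=> [a x y|] /=; first by rewrite lg lf.
exists (`|M| * N) => x /=; apply: (le_trans (fM _)).
apply: (@le_trans _ _ (`|M|%:C * `|g x|)).
  by apply: ler_wpM2r => //; rewrite lecR ler_norm.
by rewrite rmorphM -mulrA ler_wpM2l// lecR.
Qed.

Definition bop_one : bop := Bop bounded_linear_id.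
Definition bop_mul (f g : bop) : bop := Bop (bounded_linear_comp f g).

Lemma bop_mulA : associative bop_mul.
Proof. by move=> f g h; apply/val_inj. Qed.
Lemma bop_mul1l : left_id bop_one bop_mul.
Proof. by move=> f; apply/val_inj. Qed.
Lemma bop_mul1r : right_id bop_one bop_mul.
Proof. by move=> f; apply/val_inj. Qed.
Lemma bop_mulDl : left_distributive bop_mul +%R.
Proof. by move=> f g h; apply/val_inj. Qed.
Lemma bop_mulDr : right_distributive bop_mul +%R.
Proof. by move=> f g h; apply/val_inj/funext => x; exact: bopD. Qed.

(* [pz] because the zero space, on which 1 = 0, is allowed. *)
HB.instance Definition _ := GRing.Zmodule_isPzRing.Build bop
  bop_mulA bop_mul1l bop_mul1r bop_mulDl bop_mulDr.

Implicit Types (S T P J : bop).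

(* In [adjoint] (Riesz), [sqrt_op] (for positive arguments, the only ones it is
   applied to) and [range_proj], the operator selected by [xget] exists and is
   unique; [0] is only the default value that [xget] requires. *)

Definition adjoint T : bop :=
  xget (0 : bop) [set S : bop | forall x y, inner (T x) y = inner x (S y)].

Definition selfadjoint T := adjoint T = T.

(* Over the complex numbers, [0 <= z] says that [z] is real and nonnegative. *)
Definition positive_op T := forall x, 0 <= inner (T x) x.

Definition sqrt_op T : bop :=
  xget (0 : bop) [set S : bop | positive_op S /\ S * S = T].

Definition abs_op T : bop := sqrt_op (adjoint T * T).

Definition pos_part S : bop := 2^-1 *: (abs_op S + S).

Definition range_proj T : bop :=
  xget (0 : bop) [set E : bop | [/\ E * E = E, selfadjoint E &
                      range (E : H -> H) = closure (range (T : H -> H))]].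

Definition is_idempotent P := P * P = P.

(* [J * J = 1] expresses [J = J^-1]. *)
Definition is_symmetry J := selfadjoint J /\ J * J = 1.

Definition Gamma P : set bop := [set J | is_symmetry J /\ J * P * J = 1 - P].

Definition Delta P : set bop :=
  [set J | is_symmetry J /\ J * P * J = 1 - adjoint P].

End BoundedOperators.

(* Main.v *)
Require Import Defs.
From mathcomp Require Import all_boot all_order all_algebra.
From mathcomp Require Import sesquilinear complex.
From mathcomp Require Import all_classical all_reals all_analysis.
From mathcomp Require Import ring lra.

Set Implicit Arguments.
Unset Strict Implicit.
Unset Printing Implicit Defensive.

Local Open Scope classical_set_scope.
Local Open Scope ring_scope.

Import Order.TTheory GRing.Theory Num.Theory.
Import numFieldNormedType.Exports.

(** Write [Q] for the adjoint of [P] and [A = P + Q - 1]. From [P * P = P] one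
    gets [A * P = Q * P = Q * A], so [A] exchanges [P] and [Q] and [A * A]
    commutes with both; moreover [A * A = 1 + (P - Q) * (Q - P)] is at least
    [1] as a quadratic form ([idempotent_shift]). The spectrum of [A] therefore
    avoids the interval between [-1] and [1], and [A] has a sign
    [U = A * |A|^-1], a symmetry that inherits the exchange: [U * P * U = Q]
    ([sign_exists]).

    This [U] is the operator [2 E - 1] of the statement, where [E] projects onto the
    closure of the range of the positive part of [P + Q = A + 1]
    ([range_proj_pos_part]). Indeed [A + 1] has the same sign as [A] wherever it
    does not vanish, hence [|A + 1| = U * (A + 1) = |A| + U], and with
    [F = (1 + U) / 2] the positive part is [F * (A + 1) = F * (|A| + 1)], whose
    range is that of [F] because [|A| + 1] is invertible.

    If [J * P * J = 1 - Q], taking adjoints gives [J * Q * J = 1 - P], so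
    [J * A * J = - A], and [J] anticommutes with [U] as well. Conversely, if
    ['i J U] is self-adjoint then [J] anticommutes with [U]. Under this
    anticommutation ['i J U] is a symmetry and conjugation by it sends [P] to
    [J * Q * J], so each membership says the same as the other up to adjoints.

    The analysis behind this is the existence of adjoints (the Riesz theorem
    [riesz_real], by minimising a quadratic functional), of inverses of
    operators bounded below by a positive constant ([coercive_inv]), and the
    existence and uniqueness of positive square roots ([coercive_sqrt],
    [sqrt_unique]). Existence is only established for operators bounded below by
    a positive constant, where an iteration converges geometrically; uniqueness
    in general is obtained from it by perturbation. All limits are limits of
    sequences whose increments decay geometrically. Estimates are carried out
    with the real part of the inner product and the real-valued norm. *)

(** * The underlying real inner product space *)

Section RealStructure.
Variables (R : realType) (H : hilbertType R).
Implicit Types (x y z : H) (a b : R).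
Local Open Scope complex_scope.

Definition rdot x y : R := complex.Re (inner x y).
Definition rnorm x : R := complex.Re `|x|.

Lemma rdotDl x y z : rdot (x + y) z = rdot x z + rdot y z.
Proof. by rewrite /rdot linearDl raddfD. Qed.

Lemma rdotC x y : rdot x y = rdot y x.
Proof. by rewrite /rdot hermC/= expr0 mul1r; case: (inner y x). Qed.

Lemma rdotNl x y : rdot (- x) y = - rdot x y.
Proof. by rewrite /rdot linearNl raddfN. Qed.

Lemma rdotZl a x y : rdot (a%:C *: x) y = a * rdot x y.
Proof.
by rewrite /rdot linearZl_LR/=; case: (inner x y) => u v /=; rewrite mul0r subr0.
Qed.

(** This recovers the complex inner product from its real part, so that identities
    between inner products can be proved on real parts only. *)
Lemma Im_inner x y : complex.Im (inner x y) = - rdot ('i *: x) y.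
Proof. by rewrite /rdot linearZl_LR/=; case: (inner x y) => u v /=; ring. Qed.

Lemma rdotDr x y z : rdot x (y + z) = rdot x y + rdot x z.
Proof. by rewrite !(rdotC x) rdotDl. Qed.

Lemma rdotNr x y : rdot x (- y) = - rdot x y.
Proof. by rewrite !(rdotC x) rdotNl. Qed.

Lemma rdotZr a x y : rdot x (a%:C *: y) = a * rdot x y.
Proof. by rewrite !(rdotC x) rdotZl. Qed.

Definition rdotE := (rdotDl, rdotDr, rdotNl, rdotNr, rdotZl, rdotZr).

Lemma rnorm_ge0 x : 0 <= rnorm x.
Proof. by have := normr_ge0 x; rewrite lecE => /andP[]. Qed.

Lemma rnormE x : `|x| = (rnorm x)%:C.
Proof. by rewrite RRe_real// normr_real. Qed.

Lemma rdotxx x : rdot x x = rnorm x ^+ 2.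
Proof. by rewrite /rdot innerE rnormE -rmorphXn. Qed.

Lemma rnormD x y : rnorm (x + y) <= rnorm x + rnorm y.
Proof. by have := ler_normD x y; rewrite !rnormE -rmorphD lecR. Qed.

Lemma rnormN x : rnorm (- x) = rnorm x.
Proof. by rewrite /rnorm normrN. Qed.

Lemma rnormBC x y : rnorm (x - y) = rnorm (y - x).
Proof. by rewrite -rnormN opprB. Qed.

Lemma rnormZ a x : rnorm (a%:C *: x) = `|a| * rnorm x.
Proof.
rewrite /rnorm normrZ [`|a%:C|]normc_def/= expr0n/= addr0 sqrtr_sqr rnormE /=.
by rewrite mul0r subr0.
Qed.

Lemma rnorm_eq0 x : rnorm x <= 0 -> x = 0.
Proof.
move=> x0; apply: normr0_eq0; rewrite rnormE (_ : rnorm x = 0)//.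
by apply/le_anti; rewrite x0 rnorm_ge0.
Qed.

(** Cauchy-Schwarz: expand the squared norm of [rnorm y *: x - rnorm x *: y]. *)
Lemma rdot_le x y : rdot x y <= rnorm x * rnorm y.
Proof.
have := rnorm_ge0 x; have := rnorm_ge0 y.
have [/rnorm_eq0 -> |y0 _ x_ge0] := leP (rnorm y) 0.
  by move=> _ _; rewrite -(scale0r 0) (rdotZr 0) rnormZ mul0r normr0 mul0r mulr0.
have := sqr_ge0 (rnorm ((rnorm y)%:C *: x - (rnorm x)%:C *: y)).
rewrite -rdotxx !rdotE (rdotC y x) !rdotxx.
have [/rnorm_eq0 x0|x0] := leP (rnorm x) 0.
  by move=> _; rewrite x0 -(scale0r 0) (rdotZl 0) rnormZ mul0r normr0 !mul0r.
have -> : rnorm y * (rnorm y * rnorm x ^+ 2 + - (rnorm x * rdot x y)) +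
  - (rnorm x * (rnorm y * rdot x y + - (rnorm x * rnorm y ^+ 2))) =
  (2 * (rnorm x * rnorm y)) * (rnorm x * rnorm y - rdot x y) by ring.
by rewrite pmulr_rge0 ?subr_ge0// !mulr_gt0.
Qed.

Lemma rdot_abs x y : `|rdot x y| <= rnorm x * rnorm y.
Proof.
by rewrite ler_norml rdot_le andbT lerNl -rdotNl -(rnormN x) rdot_le.
Qed.

Lemma rdot_inj x y : (forall z, rdot z x = rdot z y) -> x = y.
Proof.
move=> xy; apply/eqP; rewrite -subr_eq0; apply/eqP/rnorm_eq0.
have : rnorm (x - y) ^+ 2 = 0 by rewrite -rdotxx rdotDr rdotNr xy subrr.
by move/eqP; rewrite sqrf_eq0 => /eqP ->.
Qed.

End RealStructure.

(** * Completeness and the Riesz theorem *)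

Section Completeness.
Variables (R : realType) (H : hilbertType R).
Local Open Scope complex_scope.

Lemma expr_small (r K e : R) : 0 <= r < 1 -> 0 < e -> exists N, K * r ^+ N < e.
Proof.
move=> /andP[r0 r1] e0.
have : K * r ^+ n @[n --> \oo] --> K * 0.
  by apply: cvgMr; apply: cvg_expr; rewrite ger0_norm.
rewrite mulr0 => /cvgrPdist_lt /(_ e e0) [N _ /(_ N (leqnn N))] /=.
rewrite sub0r normrN => h; exists N; exact: le_lt_trans (ler_norm _) h.
Qed.

(** Every limit argument on operators ends here: an equality holds in the
    limit because the defect is at most [K * r ^+ n] for every [n]. *)
Lemma le0_geometric (r K a : R) :
  0 <= r < 1 -> (forall n, a <= K * r ^+ n) -> a <= 0.
Proof.
move=> rP h; rewrite leNgt; apply/negP => a0.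
have [N] := @expr_small _ K _ rP a0.
by rewrite ltNge h.
Qed.

(** The increments sum to at most [C / (1 - r) * r ^+ n] from rank [n] on, so the
    sequence is Cauchy and the same bound passes to the limit. *)
Lemma geometric_cvg (u : nat -> H) (C r : R) : 0 <= r < 1 ->
  (forall n, rnorm (u n.+1 - u n) <= C * r ^+ n) ->
  exists z, forall n, rnorm (z - u n) <= C / (1 - r) * r ^+ n.
Proof.
move=> rP hu; have /andP[r0 r1] := rP.
have r1' : 0 < 1 - r by rewrite subr_gt0.
have C0 : 0 <= C.
  by have := hu 0; rewrite expr0 mulr1; apply: le_trans; exact: rnorm_ge0.
set K := C / (1 - r).
have K0 : 0 <= K by rewrite divr_ge0// ltW.
have tail n k : rnorm (u (n + k)%N - u n) <= K * r ^+ n.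
  suff h : rnorm (u (n + k)%N - u n) <= K * (r ^+ n - r ^+ (n + k)).
    apply: le_trans h _; apply: ler_wpM2l => //.
    by rewrite lerBlDr lerDl exprn_ge0.
  elim: k => [|k IH]; first by rewrite addn0 !subrr /rnorm normr0 mulr0.
  rewrite addnS -(subrKA (u (n + k)%N)); apply: le_trans (rnormD _ _) _.
  have -> : K * (r ^+ n - r ^+ (n + k).+1) =
      C * r ^+ (n + k) + K * (r ^+ n - r ^+ (n + k)).
    by rewrite /K exprS; field; rewrite gt_eqF.
  exact: lerD.
have ucvg : cvg (u @ \oo).
  apply/cauchy_cvgP/cauchy_exP => eps eps0.
  have [e eE] : exists e : R, eps = e%:C by apply/complex_realP/gtr0_real.
  have e0 : 0 < e by move: eps0; rewrite eE ltcR.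
  have [N hN] := @expr_small _ K _ rP e0.
  exists (u N); exists N => //= m /= Nm.
  rewrite -ball_normE /ball_ /= rnormE eE ltcR rnormBC -(subnKC Nm).
  exact: le_lt_trans (tail _ _) hN.
exists (lim (u @ \oo)) => n.
apply/ler_addgt0Pr => e e0.
have e0' : 0 < e%:C by rewrite ltcR.
have /cvgrPdist_lt /(_ _ e0') [N _ hN] : u @ \oo --> lim (u @ \oo) by [].
have /= := hN (n + N)%N (leq_addl _ _); rewrite rnormE ltcR => hz.
rewrite -(subrKA (u (n + N)%N)); apply: le_trans (rnormD _ _) _.
by rewrite addrC lerD// ltW.
Qed.

(** The functional [rnorm x ^+ 2 - 2 * phi x] is bounded below, and by the
    parallelogram law two points at which it nearly attains its infimum are
    close. A minimising sequence thus converges; at the limit [z] the first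
    variation [rdot x z - phi x] vanishes. *)
Lemma riesz_real (phi : H -> R) (c : R) :
  (forall x y, phi (x + y) = phi x + phi y) ->
  (forall a x, phi (a%:C *: x) = a * phi x) ->
  (forall x, `|phi x| <= c * rnorm x) ->
  exists z, forall x, phi x = rdot x z.
Proof.
move=> phiD phiZ phic.
pose f x := rnorm x ^+ 2 - 2 * phi x.
have f_lb x : - c ^+ 2 <= f x.
  rewrite /f; have := sqr_ge0 (rnorm x - c).
  by have := phic x; rewrite ler_norml => /andP[_]; nra.
have fne : (range f) !=set0 by exists (f 0), 0.
have finf : has_inf (range f).
  by split=> //; exists (- c ^+ 2) => _ [x _ <-]; exact: f_lb.
set m := inf (range f).
have m_lb x : m <= f x by apply: (inf_lbound finf.2); exists x.
(* Values within [4^-1 ^+ n] of the infimum give increments of order [2^-1 ^+ n]. *)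
have /boolp.choice [u hu] : forall n, exists x, f x <= m + 4^-1 ^+ n.
  move=> n; have e0 : 0 < 4^-1 ^+ n :> R by rewrite exprn_gt0// invr_gt0.
  by have [_ [x _ <-] /ltW ?] := inf_adherent e0 finf; exists x.
(* The parallelogram law, with the value at the midpoint bounded below by [m]. *)
have mid x y : rnorm (x - y) ^+ 2 <= 2 * (f x - m) + 2 * (f y - m).
  have := m_lb (2^-1%:C *: (x + y)).
  by rewrite /f -!rdotxx !rdotE phiZ phiD (rdotC y x); lra.
have rP : 0 <= (2^-1 : R) < 1 by lra.
have [z hz] : exists z, forall n, rnorm (z - u n) <= 4 * 2^-1 ^+ n.
  have <- : 2 / (1 - 2^-1) = 4 :> R by field.
  apply: geometric_cvg => // n.
  have b0 : 0 <= 2 * 2^-1 ^+ n :> R by rewrite mulr_ge0// exprn_ge0//; lra.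
  rewrite -(@ler_pXn2r _ 2)// ?nnegrE ?rnorm_ge0//.
  apply: le_trans (mid _ _) _.
  rewrite exprMn -exprM mulnC exprM.
  have -> : 2^-1 ^+ 2 = 4^-1 :> R by rewrite expr2; field.
  have := hu n; have := hu n.+1; rewrite exprS.
  have : 0 <= 4^-1 ^+ n :> R by rewrite exprn_ge0.
  by lra.
exists z => x.
have key t : 0 <= t ^+ 2 * rnorm x ^+ 2 + 2 * t * (rdot x z - phi x).
  rewrite -oppr_le0.
  apply: (@le0_geometric _ (2 * `|t| * rnorm x * 4 + 1) _ rP) => n.
  have := m_lb (u n + t%:C *: x); have := hu n.
  rewrite /f -!rdotxx !rdotE phiD phiZ (rdotC (u n) x) => h1 h2.
  have h3 : 4^-1 ^+ n <= 2^-1 ^+ n :> R.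
    by apply: lerXn2r; rewrite ?nnegrE//; lra.
  have h4 : - (2 * t * (rdot x z - rdot x (u n))) <=
      2 * `|t| * rnorm x * 4 * 2^-1 ^+ n.
    rewrite -rdotNr -rdotDr.
    apply: le_trans (ler_norm _) _.
    rewrite normrN !normrM (ger0_norm (_ : 0 <= 2))// -!mulrA ler_wpM2l// ler_wpM2l//.
    apply: le_trans (rdot_abs _ _) _; rewrite ler_wpM2l ?rnorm_ge0//.
  move: h1 h2 h3 h4; set p := 2^-1 ^+ n; set q := 4^-1 ^+ n; lra.
set d := rdot x z - phi x; suff : d = 0 by rewrite /d; lra.
have n0 := sqr_ge0 (rnorm x).
(* The minimum of the quadratic [key] is at [- d / rnorm x ^+ 2]; adding [1] to the
   denominator covers the case [x = 0]. *)
have := key (- d / (rnorm x ^+ 2 + 1)); rewrite -/d.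
set N := rnorm x ^+ 2 + 1; have N0 : 0 < N by rewrite /N; lra.
have -> : (- d / N) ^+ 2 * rnorm x ^+ 2 + 2 * (- d / N) * d
  = - (d ^+ 2 * ((N + 1) / N ^+ 2)) by rewrite /N; field; rewrite gt_eqF.
rewrite oppr_ge0 pmulr_lle0; last by rewrite divr_gt0 ?exprn_gt0//; lra.
by move=> h; apply/eqP; rewrite -sqrf_eq0; apply/eqP/le_anti; rewrite h sqr_ge0.
Qed.

End Completeness.

(** * Bounded operators: norm bounds and adjoints *)

Section Operators.
Variables (R : realType) (H : hilbertType R).
Implicit Types (x y z : H) (a c r : R) (S T X Y B K W : bop H).
Local Open Scope complex_scope.

Lemma rnormZc (k : R[i]) x : rnorm (k *: x) = complex.Re `|k| * rnorm x.
Proof. by rewrite /rnorm normrZ rnormE normc_def/= mulr0 subr0. Qed.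

Lemma rdotJ (k : R[i]) x y : rdot x (k *: y) = rdot (k^* *: x) y.
Proof. by rewrite /rdot linearZr_LR linearZl_LR. Qed.

Lemma bop_scale T (k : R[i]) x : T (k *: x) = k *: T x.
Proof.
have [lT _] := bopP T; have T0 : T 0 = 0.
  by have := lT (-1) 0 0; rewrite scaler0 addr0 scaleN1r addNr.
by have := lT k x 0; rewrite !addr0 T0 addr0.
Qed.

Lemma bop_opp T x : T (- x) = - T x.
Proof. by rewrite -(scaleN1r x) bop_scale scaleN1r. Qed.

Lemma bopB T x y : T (x - y) = T x - T y.
Proof. by rewrite bopD bop_opp. Qed.

Lemma bop_ext S T : (forall x, S x = T x) -> S = T.
Proof. by move=> ST; apply/val_inj/funext. Qed.

Lemma bop_addE S T x : (S + T) x = S x + T x. Proof. by []. Qed.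
Lemma bop_oppE T x : (- T) x = - T x. Proof. by []. Qed.
Lemma bop_mulE S T x : (S * T) x = S (T x). Proof. by []. Qed.
Lemma bop_scaleE (k : R[i]) T x : (k *: T) x = k *: T x. Proof. by []. Qed.
Lemma bop_oneE x : (1 : bop H) x = x. Proof. by []. Qed.
Lemma bop_zeroE x : (0 : bop H) x = 0. Proof. by []. Qed.
Definition bopE :=
  (bop_addE, bop_oppE, bop_mulE, bop_scaleE, bop_oneE, bop_zeroE).

Lemma bop_scalerAl (k : R[i]) S T : k *: S * T = k *: (S * T).
Proof. by apply: bop_ext. Qed.

Lemma bop_scalerAr (k : R[i]) S T : S * (k *: T) = k *: (S * T).
Proof. by apply: bop_ext => x; rewrite !bopE bop_scale. Qed.

(** A bound on the operator norm, used in place of the norm itself. *)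
Definition opbound T a := forall x, rnorm (T x) <= a * rnorm x.

Lemma opbound_exists T : exists2 a, 0 < a & opbound T a.
Proof.
have [_ [M hM]] := bopP T; exists (`|M| + 1) => [|x]; first by have := normr_ge0 M; lra.
have := hM x; rewrite !rnormE -rmorphM lecR => /le_trans; apply.
by rewrite ler_wpM2r ?rnorm_ge0//; have := ler_norm M; lra.
Qed.

Lemma opboundD S T a b : opbound S a -> opbound T b -> opbound (S + T) (a + b).
Proof.
move=> hS hT x; rewrite bopE mulrDl; apply: le_trans (rnormD _ _) _.
by apply: lerD; [exact: hS|exact: hT].
Qed.

Lemma opboundN T a : opbound T a -> opbound (- T) a.
Proof. by move=> h x; rewrite bopE rnormN; exact: h. Qed.

Lemma opboundM S T a b : 0 <= a -> opbound S a -> opbound T b -> opbound (S * T) (a * b).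
Proof.
move=> a0 hS hT x; apply: le_trans (hS _) _.
by rewrite -mulrA; apply: ler_wpM2l => //; exact: hT.
Qed.

Lemma opboundZ k T a : opbound T a -> opbound (k%:C *: T) (`|k| * a).
Proof. by move=> h x; rewrite bopE rnormZ -mulrA; apply: ler_wpM2l => //; exact: h. Qed.

Lemma opbound_le T a b : a <= b -> opbound T a -> opbound T b.
Proof.
by move=> ab h x; apply: le_trans (h x) _; rewrite ler_wpM2r ?rnorm_ge0.
Qed.

Lemma opbound_geometric_eq0 T a r :
  0 <= r < 1 -> (forall n, opbound T (a * r ^+ n)) -> T = 0.
Proof.
move=> rP h; apply: bop_ext => x; apply: rnorm_eq0.
apply: (@le0_geometric _ r (a * rnorm x)) => // n.
by rewrite mulrAC; exact: h.
Qed.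

Lemma bop_of_fun (f : H -> H) a : linear f ->
  (forall x, rnorm (f x) <= a * rnorm x) -> exists T, forall x, T x = f x.
Proof.
move=> lf hf.
have fb : f \in bounded_linear (H := H).
  by apply/mem_set; split=> //; exists a => x; rewrite !rnormE -rmorphM lecR.
by exists (Bop fb).
Qed.

(** Completeness of the space of bounded operators, in the form needed below: the
    limit is taken pointwise, and the uniform estimate makes it linear and
    bounded. *)
Lemma bop_geometric_cvg (Z : nat -> bop H) a r : 0 <= r < 1 ->
  (forall n, opbound (Z n.+1 - Z n) (a * r ^+ n)) ->
  exists T b, 0 <= b /\ forall n, opbound (T - Z n) (b * r ^+ n).
Proof.
move=> rP hZ; have /andP[r0 r1] := rP.
set b := a / (1 - r).
have /boolp.choice [f hf] : forall x, exists z, forall n,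
    rnorm (z - Z n x) <= b * rnorm x * r ^+ n.
  move=> x; have [|z hz] := @geometric_cvg _ _ (fun n => Z n x) (a * rnorm x) _ rP.
    by move=> n; have := hZ n x; rewrite !bopE mulrAC.
  by exists z => n; rewrite /b (mulrAC a).
have lf : linear f.
  move=> k x y; apply/eqP; rewrite -subr_eq0; apply/eqP/rnorm_eq0.
  apply: (@le0_geometric _ r
    (b * rnorm (k *: x + y) + complex.Re `|k| * (b * rnorm x) + b * rnorm y)) => // n.
  have -> : f (k *: x + y) - (k *: f x + f y) =
      (f (k *: x + y) - Z n (k *: x + y)) + - (k *: (f x - Z n x))
      + - (f y - Z n y).
    by rewrite bopD bop_scale scalerBr !opprB -addrA (addrACA (k *: Z n x)) -opprD subrKA.
  rewrite !mulrDl; apply: le_trans (rnormD _ _) _; rewrite rnormN; apply: lerD => //.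
  apply: le_trans (rnormD _ _) _; rewrite rnormN; apply: lerD => //.
  rewrite rnormZc -mulrA; apply: ler_wpM2l; last exact: hf.
  by have := normr_ge0 k; rewrite lecE => /andP[].
have [c _ hc] := opbound_exists (Z 0).
have [x|T hT] := @bop_of_fun f (b + c) lf.
  rewrite -(subrK (Z 0 x) (f x)) mulrDl; apply: le_trans (rnormD _ _) _.
  by apply: lerD => //; have := hf x 0; rewrite expr0 mulr1.
exists T, `|b|; split=> // n x; rewrite !bopE hT; apply: le_trans (hf _ _) _.
by rewrite mulrAC ler_wpM2r ?rnorm_ge0// ler_wpM2r ?exprn_ge0// ler_norm.
Qed.

Lemma inner_eq x y z t : rdot x y = rdot z t -> rdot ('i *: x) y = rdot ('i *: z) t ->
  inner x y = inner z t.
Proof.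
move=> hr hi; apply/eqP; rewrite eq_complex; apply/andP; split; apply/eqP => //.
by rewrite !Im_inner hi.
Qed.

(** An identity between real parts suffices, by replacing [x] with ['i *: x]. *)
Lemma adjoint_eq T S :
  (forall x y, rdot (T x) y = rdot x (S y)) -> adjoint T = S.
Proof.
move=> TS.
have TSi x y : inner (T x) y = inner x (S y).
  by apply: inner_eq; rewrite // -bop_scale.
rewrite /adjoint; case: xgetP => [S' _ /= hS'|/(_ S) []//].
apply: bop_ext => y; apply: rdot_inj => x.
by rewrite -TS /rdot hS'.
Qed.

(** The Riesz theorem represents [x |-> rdot (T x) y] for each [y]; uniqueness of
    the representing vector makes it complex-linear in [y]. *)
Lemma adjointP T x y : rdot (T x) y = rdot x (adjoint T y).
Proof.
have [c c0 hc] := opbound_exists T.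
have /boolp.choice [f hf] : forall y, exists z, forall x, rdot (T x) y = rdot x z.
  move=> {}y; apply: (@riesz_real _ _ _ (c * rnorm y)) => [u v|a u|u].
  - by rewrite bopD rdotDl.
  - by rewrite bop_scale rdotZl.
  - by apply: le_trans (rdot_abs _ _) _; rewrite mulrAC ler_wpM2r ?rnorm_ge0.
have lf : linear f.
  move=> k u v; apply: rdot_inj => z.
  by rewrite rdotDr rdotJ -!hf rdotDr rdotJ bop_scale.
have [u|S hS] := @bop_of_fun f c lf.
  have [/rnorm_eq0 ->|f0] := leP (rnorm (f u)) 0.
    by rewrite /rnorm normr0 mulr_ge0 ?rnorm_ge0// ltW.
  rewrite -(ler_pM2l f0) -expr2 -rdotxx -hf; apply: le_trans (rdot_le _ _) _.
  by rewrite mulrCA mulrA ler_wpM2r ?rnorm_ge0.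
by rewrite (@adjoint_eq T S) => [|u v]; rewrite hS hf.
Qed.

Definition sym_op T := forall x y, rdot (T x) y = rdot x (T y).

Lemma selfadjointP T : selfadjoint T <-> sym_op T.
Proof.
split=> [h x y|h]; last exact: adjoint_eq.
by rewrite adjointP h.
Qed.

Lemma adjointM S T : adjoint (S * T) = adjoint T * adjoint S.
Proof. by apply: adjoint_eq => x y; rewrite !bopE !adjointP. Qed.

Lemma adjointK T : adjoint (adjoint T) = T.
Proof. by apply: adjoint_eq => x y; rewrite rdotC -adjointP rdotC. Qed.

Lemma adjointB S T : adjoint (S - T) = adjoint S - adjoint T.
Proof. by apply: adjoint_eq => x y; rewrite !bopE !rdotE !adjointP. Qed.

Lemma adjointD S T : adjoint (S + T) = adjoint S + adjoint T.
Proof. by apply: adjoint_eq => x y; rewrite !bopE !rdotE !adjointP. Qed.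

Lemma adjointZ (k : R[i]) T : adjoint (k *: T) = k^* *: adjoint T.
Proof.
by apply: adjoint_eq => x y; rewrite !bopE rdotJ ?conjcK ?conjCK -bop_scale adjointP.
Qed.

Lemma adjoint1 : adjoint 1 = 1 :> bop H.
Proof. exact: adjoint_eq. Qed.

Lemma sym_opD S T : sym_op S -> sym_op T -> sym_op (S + T).
Proof. by move=> hS hT x y; rewrite !bopE !rdotE hS hT. Qed.

Lemma sym_opN T : sym_op T -> sym_op (- T).
Proof. by move=> hT x y; rewrite !bopE !rdotE hT. Qed.

Lemma sym_opZ a T : sym_op T -> sym_op (a%:C *: T).
Proof. by move=> hT x y; rewrite !bopE !rdotE hT. Qed.

Lemma sym_opM S T : sym_op S -> sym_op T -> S * T = T * S -> sym_op (S * T).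
Proof. by move=> hS hT ST x y; rewrite {2}ST !bopE hS hT. Qed.

(** The order relation [a <= T] of quadratic forms. *)
Definition form_ge T a := forall x, a * rnorm x ^+ 2 <= rdot (T x) x.

End Operators.

(** * Inverses and square roots by iteration *)

Section FunctionalCalculus.
Variables (R : realType) (H : hilbertType R).
Implicit Types (x y z : H) (a c r q : R) (S T X Y Z B K W : bop H).
Local Open Scope complex_scope.

(** For [0 <= X <= q] the form of [X ^ 2] is at most [q] times that of [X], since
    [q X (q - X) = X (q - X) X + (q - X) X (q - X)] is nonnegative. This gives the
    sharp norm bound from the bound on the form. *)
Lemma opbound_of_form X q : 0 < q -> sym_op X -> form_ge X 0 ->
  (forall x, rdot (X x) x <= q * rnorm x ^+ 2) -> opbound X q.
Proof.
move=> q0 sX X0 Xq x.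
have X0' y : 0 <= rdot (X y) y by have := X0 y; rewrite mul0r.
have qX0 y : 0 <= q * rdot y y - rdot (X y) y by rewrite rdotxx subr_ge0.
have h : rnorm (X x) ^+ 2 <= q * rdot (X x) x.
  rewrite -subr_ge0 -(pmulr_rge0 _ q0).
  (* The forms of [X] at [(q - X) x] and of [q - X] at [X x] add up to
     [q (q (X x, x) - rnorm (X x) ^+ 2)]. *)
  have := addr_ge0 (X0' (q%:C *: x - X x)) (qX0 (X x)).
  by rewrite -rdotxx bopB bop_scale !rdotE (sX (X x) x); lra.
rewrite -(@ler_pXn2r _ 2)// ?nnegrE ?rnorm_ge0//; last first.
  by rewrite mulr_ge0 ?rnorm_ge0// ltW.
apply: le_trans h _; rewrite exprMn expr2 -mulrA ler_wpM2l// ltW//.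
Qed.

(** Dividing by a large [M] brings [T] within distance less than [1] of the
    identity. The distance must be exactly [1 - c / M] for the lower bound in
    [coercive_sqrt] to come out as [c]. *)
Lemma coercive_scaling T c : sym_op T -> 0 < c -> form_ge T c ->
  exists2 M, c < M & opbound (1 - (M^-1)%:C *: T) (1 - c / M).
Proof.
move=> sT c0 Tc; have [M0 M00 hM0] := opbound_exists T.
exists (M0 + c); first lra.
set M := M0 + c; have M1 : 0 < M by rewrite /M; lra.
have Mc : c / M < 1 by rewrite ltr_pdivrMr// /M; lra.
apply: opbound_of_form => [||x|x].
- by rewrite subr_gt0.
- exact/sym_opD/sym_opN/sym_opZ.
- rewrite mul0r !bopE !rdotE rdotxx subr_ge0.
  rewrite mulrC ler_pdivrMr//; apply: le_trans (rdot_le _ _) _.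
  rewrite mulrC expr2 -mulrA; apply: ler_wpM2l; first exact: rnorm_ge0.
  apply: le_trans (hM0 x) _; rewrite mulrC ler_wpM2l ?rnorm_ge0//.
  by rewrite /M; lra.
- rewrite !bopE !rdotE rdotxx mulrBl mul1r lerD2l lerN2 mulrAC mulrC.
  by rewrite ler_wpM2l ?invr_ge0// ltW.
Qed.

Lemma commute_limit (Z : nat -> bop H) V W b r : 0 <= r < 1 -> 0 <= b ->
  (forall n, opbound (V - Z n) (b * r ^+ n)) ->
  (forall n, W * Z n = Z n * W) -> W * V = V * W.
Proof.
move=> rP b0 hV comZ; have /andP[r0 r1] := rP.
have [w w0 hW] := opbound_exists W.
apply/subr0_eq/(@opbound_geometric_eq0 _ _ _ (w * b + b * w) r rP) => n.
have -> : W * V - V * W = W * (V - Z n) - (V - Z n) * W.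
  by rewrite mulrBr mulrBl comZ opprB addrA subrK.
rewrite (mulrDl (w * b)) -(mulrA w) (mulrAC b).
apply: opboundD; [|apply: opboundN]; apply: opboundM => //; first exact: ltW.
by rewrite mulr_ge0// exprn_ge0.
Qed.

(** The Neumann series, as the fixed point of [Z |-> 1 + X * Z]. *)
Lemma neumann X q : 0 <= q < 1 -> opbound X q ->
  exists Z, Z * (1 - X) = 1 /\ (1 - X) * Z = 1.
Proof.
move=> qP hX; have /andP[q0 q1] := qP.
pose Z := fix Z n : bop H := if n is k.+1 then 1 + X * Z k else 0.
have Z0 : Z 0 = 0 by [].
have ZS n : Z n.+1 = 1 + X * Z n by [].
have dZ n : opbound (Z n.+1 - Z n) (1 * q ^+ n).
  elim: n => [|n IH].
    by move=> x; rewrite ZS Z0 mulr0 addr0 subr0 bopE expr0 !mul1r.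
  rewrite !ZS opprD addrACA subrr add0r -mulrBr mul1r exprS.
  by apply: opboundM => //; rewrite -[q ^+ n]mul1r; exact: IH.
have [V [b [b0 hV]]] := bop_geometric_cvg qP dZ.
have fixV : V - (1 + X * V) = 0.
  apply: (@opbound_geometric_eq0 _ _ _ (b * q + q * b) q qP) => n.
  have -> : V - (1 + X * V) = (V - Z n.+1) - X * (V - Z n).
    by rewrite ZS mulrBr -[RHS]addrA -opprD -(addrA 1) subrKC.
  rewrite (mulrDl (b * q)) -!mulrA -exprS.
  by apply: opboundD; [|apply/opboundN/opboundM].
have comV : X * V = V * X.
  apply: (commute_limit qP b0 hV) => n.
  elim: n => [|n IH]; first by rewrite Z0 mulr0 mul0r.
  by rewrite ZS mulrDr mulrDl mulr1 mul1r -mulrA -IH.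
exists V; move/subr0_eq: fixV => fixV.
rewrite mulrBr mulrBl mulr1 mul1r -comV {1 3}fixV.
by split; rewrite addrK.
Qed.

Lemma coercive_inv T c : sym_op T -> 0 < c -> form_ge T c ->
  exists V, V * T = 1 /\ T * V = 1.
Proof.
move=> sT c0 Tc; have [M cM hX] := coercive_scaling sT c0 Tc.
have M0 : 0 < M by lra.
have qP : 0 <= 1 - c / M < 1.
  by rewrite subr_ge0 ler_pdivrMr// mul1r (ltW cM)/= ltrBlDr ltrDl divr_gt0.
have [Z [ZX XZ]] := neumann qP hX.
exists ((M^-1)%:C *: Z); move: ZX XZ.
rewrite !subKr bop_scalerAl bop_scalerAr => ZX XZ; split=> //.
by rewrite bop_scalerAr -XZ bop_scalerAl.
Qed.

(** Writing the root as [1 - Y], the equation becomes [Y = (X + Y * Y) / 2], whose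
    right-hand side is a contraction of ratio [r] on the ball of radius [r]; the
    bound on [X] is what makes this ball stable. The iterates from [0] are
    polynomials in [X], so they commute with whatever commutes with [X]. *)
Lemma sqrt_one_sub X r : 0 <= r < 1 -> sym_op X -> opbound X (1 - (1 - r) ^+ 2) ->
  exists Y, [/\ sym_op Y, opbound Y r, (1 - Y) * (1 - Y) = 1 - X &
    forall W, W * X = X * W -> W * Y = Y * W].
Proof.
move=> rP sX hX; have /andP[r0 r1] := rP.
pose h := (2^-1)%:C : R[i].
pose Y := fix Y n : bop H := if n is k.+1 then h *: (X + Y k * Y k) else 0.
have Y0 : Y 0 = 0 by [].
have YS n : Y n.+1 = h *: (X + Y n * Y n) by [].
have absh : `|2^-1| = 2^-1 :> R by rewrite ger0_norm// invr_ge0.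
have nbY n : opbound (Y n) r.
  elim: n => [|n IH].
    by move=> x; rewrite Y0 bopE /rnorm normr0 mulr_ge0// rnorm_ge0.
  rewrite YS; apply: (@opbound_le _ _ _ (`|2^-1| * (1 - (1 - r) ^+ 2 + r * r))).
    rewrite absh; nra.
  by apply: opboundZ; apply: opboundD => //; apply: opboundM.
have dY n : opbound (Y n.+1 - Y n) (2^-1 * (1 - (1 - r) ^+ 2) * r ^+ n).
  elim: n => [|n IH].
    by rewrite YS Y0 mul0r addr0 subr0 expr0 mulr1 -absh; exact: opboundZ.
  have -> : Y n.+2 - Y n.+1 =
      h *: (Y n.+1 * (Y n.+1 - Y n) + (Y n.+1 - Y n) * Y n).
    rewrite (YS n.+1) (YS n) -scalerBr -(YS n); congr (_ *: _).
    by rewrite opprD addrACA subrr add0r mulrBr mulrBl addrA subrK.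
  set d := 2^-1 * (1 - (1 - r) ^+ 2) * r ^+ n in IH *.
  apply: (@opbound_le _ _ _ (`|2^-1| * (r * d + d * r))).
    by rewrite absh /d (exprS r n); set u := r ^+ n; lra.
  have d0 : 0 <= d.
    rewrite /d !mulr_ge0 ?invr_ge0// ?exprn_ge0//; nra.
  by apply: opboundZ; apply: opboundD; apply: opboundM.
have [V [b [b0 hV]]] := bop_geometric_cvg rP dY.
have sV : sym_op V.
  have sY n : sym_op (Y n).
    elim: n => [|n IH].
      by move=> x y; rewrite Y0 !bopE -(scale0r 0) (rdotZl 0) (rdotZr 0) !mul0r.
    by rewrite YS; apply/sym_opZ/sym_opD => //; apply: sym_opM.
  have le1 x y : rdot (V x) y <= rdot x (V y).
    rewrite -subr_le0.
    apply: (@le0_geometric _ r (2 * b * rnorm x * rnorm y) _ rP) => n.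
    have -> : rdot (V x) y - rdot x (V y) =
        rdot ((V - Y n) x) y - rdot x ((V - Y n) y).
      by rewrite !bopE !rdotE (sY n x y); ring.
    have h1 : rdot ((V - Y n) x) y <= b * r ^+ n * rnorm x * rnorm y.
      by apply: le_trans (rdot_le _ _) _; rewrite ler_wpM2r ?rnorm_ge0//; exact: hV.
    have h2 : - rdot x ((V - Y n) y) <= b * r ^+ n * rnorm x * rnorm y.
      rewrite -rdotNl; apply: le_trans (rdot_le _ _) _; rewrite rnormN.
      have -> : b * r ^+ n * rnorm x * rnorm y = rnorm x * (b * r ^+ n * rnorm y) by ring.
      by apply: ler_wpM2l; [exact: rnorm_ge0|exact: hV].
    by move: h1 h2; set u := r ^+ n; lra.
  by move=> x y; apply/le_anti; rewrite le1 (rdotC (V x)) (rdotC x) le1.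
have nbV : opbound V r.
  move=> x; rewrite -subr_le0.
  apply: (@le0_geometric _ r (b * rnorm x) _ rP) => n.
  have := hV n x; have := nbY n x; have := rnormD (Y n x) ((V - Y n) x).
  by rewrite !bopE subrKC; set u := r ^+ n; lra.
have sqV : V - h *: (X + V * V) = 0.
  apply: (@opbound_geometric_eq0 _ _ _ (b * r + `|2^-1| * (r * b + b * r)) r rP) => n.
  have -> : V - h *: (X + V * V) =
      (V - Y n.+1) - h *: (V * (V - Y n) + (V - Y n) * Y n).
    rewrite YS mulrBr mulrBl addrA subrK scalerBr !(scalerDr h X).
    by rewrite -[RHS]addrA -opprD -(addrA (h *: X)) subrKC.
  have hn : 0 <= b * r ^+ n by rewrite mulr_ge0// exprn_ge0.
  rewrite (mulrDl (b * r)); apply: opboundD; first by rewrite -mulrA -exprS; exact: hV.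
  rewrite -(mulrA `|2^-1|) (mulrDl (r * b)) -(mulrA r) (mulrAC b).
  by apply/opboundN/opboundZ/opboundD; apply: opboundM.
exists V; split=> //.
- rewrite mulrBr mulr1 mulrBl mul1r opprB -addrA; congr (_ + _).
  have : V + V = X + V * V.
    move/subr0_eq: sqV => {1 2}->.
    rewrite -scalerDl -rmorphD (_ : 2^-1 + 2^-1 = 1 :> R) ?scale1r//.
    by field.
  move=> e; have -> : X = V + V - V * V by rewrite e addrK.
  by rewrite opprB opprD addrCA.
- move=> W WX; apply: (commute_limit rP b0 hV) => n.
  elim: n => [|n IH]; first by rewrite Y0 mulr0 mul0r.
  rewrite YS bop_scalerAl bop_scalerAr; congr (_ *: _).
  by rewrite mulrDr mulrDl WX mulrA IH -!mulrA IH.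
Qed.

End FunctionalCalculus.

(** * Positive square roots, absolute values and range projections *)

Section PositiveRoots.
Variables (R : realType) (H : hilbertType R).
Implicit Types (x y z : H) (a c r q : R) (S T X Y Z B K W F G : bop H).
Local Open Scope complex_scope.

(** With [T = M (1 - X)], the root is [sqrt M (1 - Y)] for the [Y] of
    [sqrt_one_sub]. A lower bound as sharp as [c] is needed later:
    [|A| >= 1] makes [|A| + U] nonnegative for a symmetry [U]. *)
Lemma coercive_sqrt T c : sym_op T -> 0 < c -> form_ge T (c ^+ 2) ->
  exists B, [/\ sym_op B, form_ge B c, B * B = T &
    forall W, W * T = T * W -> W * B = B * W].
Proof.
move=> sT c0 Tc; have c20 : 0 < c ^+ 2 by rewrite exprn_gt0.
have [M cM hX] := coercive_scaling sT c20 Tc.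
have M0 : 0 < M by apply: lt_trans cM.
set m := Num.sqrt M; have m0 : 0 < m by rewrite sqrtr_gt0.
have mM : m ^+ 2 = M by rewrite sqr_sqrtr// ltW.
set X := 1 - _ in hX.
have sX : sym_op X by exact/sym_opD/sym_opN/sym_opZ.
have cm : c < m by rewrite -(@ltr_pXn2r _ 2)// ?mM// nnegrE ltW.
have rP : 0 <= 1 - c / m < 1.
  by rewrite subr_ge0 ler_pdivrMr// mul1r (ltW cm)/= ltrBlDr ltrDl divr_gt0.
have [|Y [sY nbY YX comY]] := @sqrt_one_sub _ _ X _ rP sX.
  by rewrite subKr expr_div_n mM.
exists (m%:C *: (1 - Y)); split.
- exact/sym_opZ/sym_opD/sym_opN.
- move=> x; rewrite !bopE !rdotE rdotxx.
  have := le_trans (rdot_le (Y x) x) (ler_wpM2r (rnorm_ge0 x) (nbY x)).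
  rewrite -mulrA -expr2 => h.
  have : m * (c / m * rnorm x ^+ 2) <= m * (rnorm x ^+ 2 - rdot (Y x) x).
    by rewrite ler_wpM2l//; [exact: ltW|lra].
  have -> // : m * (c / m * rnorm x ^+ 2) = c * rnorm x ^+ 2.
  by field; rewrite gt_eqF.
- rewrite bop_scalerAl bop_scalerAr YX scalerA -rmorphM -expr2 mM subKr.
  by rewrite scalerA -rmorphM divff ?gt_eqF// scale1r.
- move=> W WT; rewrite bop_scalerAl bop_scalerAr mulrBr mulrBl mulr1 mul1r comY//.
  by rewrite mulrBr mulrBl mulr1 mul1r bop_scalerAl bop_scalerAr WT.
Qed.

(** Since [(B + K) * (B - K) = e ^+ 2] and [B + K] is at least [e], the difference
    [B - K] is at most [e]. *)
Lemma sqrt_perturbation K B (e : R) : 0 < e -> form_ge B e -> form_ge K 0 ->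
  K * B = B * K -> B * B = K * K + (e ^+ 2)%:C *: (1 : bop H) -> opbound (B - K) e.
Proof.
move=> e0 Be K0 KB BB x; set y := (B - K) x.
(* [B * B - K * K] factors because [B] and [K] commute. *)
have eq : (B + K) y = (e ^+ 2)%:C *: x.
  rewrite -[LHS]bop_mulE; have -> : (B + K) * (B - K) = (e ^+ 2)%:C *: (1 : bop H).
    by rewrite mulrDl !mulrBr KB addrA subrK BB addrAC subrr add0r.
  by [].
have := rdot_le ((B + K) y) y; rewrite {2}eq rnormZ ger0_norm ?sqr_ge0//.
rewrite bopE rdotDl => h; have := Be y; have := K0 y; rewrite mul0r => h1 h2.
have [/le_trans->//|y0] := leP (rnorm y) 0; first by rewrite mulr_ge0 ?rnorm_ge0// ltW.
have : e * rnorm y ^+ 2 <= e ^+ 2 * rnorm x * rnorm y by lra.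
by rewrite !expr2 mulrA (ler_pM2r y0) -mulrA (ler_pM2l e0).
Qed.

(** The operators [B] and [K] need not commute with each other, but both commute
    with the root of [K * K + e ^+ 2] given by [coercive_sqrt], and both are
    within [e] of it. *)
Lemma sqrt_unique B K : sym_op K -> form_ge K 0 -> form_ge B 0 ->
  B * B = K * K -> B = K.
Proof.
move=> sK K0 B0 BK; apply/subr0_eq/bop_ext => x; apply: rnorm_eq0.
apply/ler_addgt0Pl => e0 e00; rewrite addr0.
(* The two estimates below add up to [2 * e * rnorm x], which must be at most [e0]. *)
pose e := e0 / (2 * rnorm x + 1).
have d0 : 0 < 2 * rnorm x + 1 by have := rnorm_ge0 x; lra.
have ep : 0 < e by rewrite divr_gt0.
have [||Q [sQ Qe QQ comQ]] := @coercive_sqrt (K * K + (e ^+ 2)%:C *: (1 : bop H)) e _ ep.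
- by apply: sym_opD; [exact: sym_opM|exact: sym_opZ].
- move=> y; rewrite !bopE !rdotE rdotxx sK rdotxx.
  by have := sqr_ge0 (rnorm (K y)); lra.
have com W : W * (K * K) = K * K * W -> W * Q = Q * W.
  move=> WK; apply: comQ.
  by rewrite mulrDr mulrDl WK bop_scalerAl bop_scalerAr mulr1 mul1r.
have hK := sqrt_perturbation ep Qe K0 (com K (mulrA _ _ _)) QQ.
have hB : opbound (Q - B) e.
  apply: (sqrt_perturbation ep Qe B0); last by rewrite BK.
  by apply: com; rewrite -BK mulrA.
rewrite bopE -(subrKA (Q x)).
apply: le_trans (rnormD _ _) _; rewrite rnormBC.
have : e * rnorm x + e * rnorm x <= e0.
  have -> : e * rnorm x + e * rnorm x = e0 * (2 * rnorm x) / (2 * rnorm x + 1).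
    by rewrite /e; field; rewrite gt_eqF.
  by rewrite ler_pdivrMr// ler_wpM2l//; lra.
apply: le_trans; apply: lerD; [exact: hB|exact: hK].
Qed.

(** The real form only controls real parts; symmetry makes the form real. *)
Lemma sym_positive_op T : sym_op T -> form_ge T 0 -> positive_op T.
Proof.
move=> sT T0 x; rewrite lecE; apply/andP; split; last first.
  by have := T0 x; rewrite mul0r.
have h1 : complex.Im (inner (T x) x) = complex.Im (inner x (T x)).
  by rewrite !Im_inner -bop_scale sT.
have h2 : complex.Im (inner (T x) x) = - complex.Im (inner x (T x)).
  by rewrite hermC/= expr0 mul1r; case: (inner x (T x)).
by apply/eqP => /=; lra.
Qed.

Lemma abs_opE S K : sym_op S -> sym_op K -> form_ge K 0 -> K * K = S * S ->
  abs_op S = K.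
Proof.
move=> /selfadjointP sS sK K0 KS; rewrite /abs_op /sqrt_op sS.
have Kpos : positive_op K by exact: sym_positive_op.
case: xgetP => [B _ [Bpos BB]|/(_ K) []//].
apply: sqrt_unique => //; last by rewrite KS.
by move=> x; have := Bpos x; rewrite lecE mul0r => /andP[].
Qed.

(** The factorisation [T * G = F] makes the range of [T] equal to that of [F], which
    is closed as the kernel of [1 - F]. *)
Lemma closure_range F T G : F * F = F -> F * T = T -> T * G = F ->
  closure (range (T : H -> H)) = range (F : H -> H).
Proof.
move=> FF FT TG; apply/seteqP; split=> [x xcl|_ [x _ <-]]; last first.
  by apply: subset_closure; exists (G x); rewrite // -bop_mulE TG.
exists x => //; apply/esym/eqP; rewrite -subr_eq0; apply/eqP/rnorm_eq0.
have [M M0 hM] := opbound_exists F.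
apply/ler_addgt0Pl => e e0; rewrite addr0.
have d0 : 0 < e / (1 + M) by rewrite divr_gt0//; lra.
have d0' : 0 < (e / (1 + M))%:C by rewrite ltcR.
have [_ [[y _ <-]]] := xcl _ (nbhsx_ballx x _ d0').
rewrite -ball_normE /ball_ /= rnormE ltcR => hy.
have -> : x - F x = (x - T y) - F (x - T y).
  by rewrite bopB -[F (T y)]bop_mulE FT opprB addrA subrK.
apply: le_trans (rnormD _ _) _; rewrite rnormN.
apply: (@le_trans _ _ ((1 + M) * rnorm (x - T y))).
  by rewrite mulrDl mul1r lerD2l; exact: hM.
by rewrite mulrC -ler_pdivlMr; [exact: ltW|lra].
Qed.

(** Two self-adjoint idempotents with the same range satisfy [E * F = F] and
    [F * E = E], hence coincide on taking adjoints. *)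
Lemma range_projE T F : F * F = F -> sym_op F ->
  range (F : H -> H) = closure (range (T : H -> H)) -> range_proj T = F.
Proof.
move=> FF sF rF; rewrite /range_proj.
case: xgetP => [E _ [EE sE rE]|/(_ F) []]; last by split=> //; exact/selfadjointP.
have absorb (A B : bop H) : A * A = A ->
    range (A : H -> H) = range (B : H -> H) -> A * B = B.
  move=> AA AB; apply: bop_ext => x; rewrite bopE.
  have [y _ <-] : range (A : H -> H) (B x) by rewrite AB; exists x.
  by rewrite -bop_mulE AA.
have EF : E * F = F by apply: absorb; rewrite // rE.
have FE : F * E = E by apply: absorb; rewrite // rE.
by rewrite -sE -FE adjointM sE (_ : adjoint F = F)//; exact/selfadjointP.
Qed.

End PositiveRoots.

(** * The sign of a shifted idempotent *)

Section SignOfIdempotent.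
Variables (R : realType) (H : hilbertType R).
Implicit Types (x y z : H) (A B F G J K P Q S T U V W : bop H).
Local Open Scope complex_scope.

(** The sign is [A * V] with [V] the inverse of the root [B] of [A * A]. As [V]
    commutes with the commutant of [A * A], any intertwining relation satisfied
    by [A] passes to the sign; it is used for [A] itself, for the exchange of [P]
    with its adjoint, and for anticommutation with [J]. *)
Lemma sign_exists A : sym_op A -> form_ge (A * A) 1 ->
  exists U, [/\ sym_op U, U * U = 1, form_ge (U * A) 1 &
    forall W W', W * (A * A) = A * A * W -> A * W = W' * A -> U * W = W' * U].
Proof.
move=> sA A1; have sAA : sym_op (A * A) by exact: sym_opM.
have [||B [sB B1 BB comB]] := @coercive_sqrt _ _ (A * A) 1 sAA; first exact: ltr01.
  by rewrite expr1n.
have [V [VB BV]] := coercive_inv sB ltr01 B1.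
have comV W : W * (A * A) = A * A * W -> W * V = V * W.
  move=> /comB WB; rewrite -[LHS]mul1r -VB -mulrA (mulrA B) -WB.
  by rewrite -[W * B * V]mulrA BV mulr1.
have AV : A * V = V * A by apply: comV; rewrite mulrA.
have sV : sym_op V.
  by move=> x y; rewrite -{1}[y]/((1 : bop H) y) -BV bop_mulE -sB -bop_mulE BV.
exists (A * V); split=> [||x|W W' /comV WV AW].
- exact: sym_opM.
- by rewrite {1}AV -mulrA (mulrA A A V) -BB -mulrA BV mulr1.
- suff -> : A * V * A = B by exact: B1.
  by rewrite AV -mulrA -BB mulrA VB mul1r.
- by rewrite -mulrA -WV mulrA AW mulrA.
Qed.

(** Here [U * A] stands for [|A|]. As [U * A] is at least [1] and [U] is at least
    [-1], the operator [U * (A + 1) = U * A + U] is nonnegative, hence is the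
    absolute value of [A + 1]. *)
Lemma range_proj_pos_part A U : sym_op A -> sym_op U -> U * U = 1 ->
  U * A = A * U -> form_ge (U * A) 1 ->
  2 *: range_proj (pos_part (A + 1)) - 1 = U.
Proof.
move=> sA sU UU UAC B1.
have sB : sym_op (U * A) by exact: sym_opM.
set S := A + 1; have sS : sym_op S by exact: sym_opD.
have US : U * S = S * U by rewrite mulrDr mulrDl UAC mulr1 mul1r.
have absS : abs_op S = U * S.
  apply: abs_opE => //; first exact: sym_opM.
  - move=> x; rewrite mul0r mulrDr mulr1 bop_addE rdotDl.
    have nmU : rnorm (U x) = rnorm x.
      apply: (@pexpIrn _ 2); rewrite ?nnegrE ?rnorm_ge0//.
      by rewrite -!rdotxx sU -bop_mulE UU.
    have := B1 x; have := rdot_abs (U x) x; rewrite nmU ler_norml => /andP[].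
    by rewrite expr2; lra.
  - by rewrite {1}US -mulrA (mulrA U U) UU mul1r.
set F := (2^-1)%:C *: (1 + U).
have h2 : (2^-1)%:C = 2^-1 :> R[i] by rewrite fmorphV/= rmorph_nat.
have FU : F * U = F by rewrite /F bop_scalerAl mulrDl UU mul1r addrC.
have FF : F * F = F.
  rewrite {2}/F bop_scalerAr mulrDr mulr1 FU scalerDr -scalerDl -rmorphD.
  by rewrite (_ : 2^-1 + 2^-1 = 1 :> R) ?scale1r//; field.
have sF : sym_op F by exact/sym_opZ/sym_opD.
have posS : pos_part S = F * S.
  by rewrite /pos_part absS -h2 /F bop_scalerAl mulrDl mul1r addrC.
have FS : F * S = F * (U * A + 1).
  by rewrite !mulrDr [in RHS]mulrA FU.
have [||x|G [GB BG]] := @coercive_inv _ _ (U * A + 1) 1.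
- exact: sym_opD.
- exact: ltr01.
- rewrite bop_addE rdotDl; have := B1 x; rewrite bop_oneE rdotxx.
  by have := sqr_ge0 (rnorm x); lra.
have -> : range_proj (pos_part S) = F.
  apply: range_projE => //; rewrite posS; apply/esym/(@closure_range _ _ _ _ G) => //.
    by rewrite mulrA FF.
  by rewrite FS -mulrA BG mulr1.
by rewrite /F h2 scalerA divff ?pnatr_eq0// scale1r addrC addKr.
Qed.

(** Multiplying out with [P * P = P] and [Q * Q = Q] gives [A * P = Q * P = Q * A]
    and [A * A = 1 + (P - Q) * (Q - P)], where the last product has the form
    [W^* W]. *)
Lemma idempotent_shift P : is_idempotent P ->
  let Q := adjoint P in let A := P + Q - 1 in
  [/\ sym_op A, form_ge (A * A) 1, A * P = Q * A &
   P * (A * A) = A * A * P].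
Proof.
move=> PP Q A; rewrite /is_idempotent in PP.
have QQ : Q * Q = Q by rewrite -adjointM PP.
have AP : A * P = Q * P by rewrite /A mulrBl mulrDl PP mul1r addrAC subrr add0r.
have AQ : A * Q = P * Q by rewrite /A mulrBl mulrDl QQ mul1r addrK.
have PA : P * A = P * Q by rewrite /A mulrBr mulrDr PP mulr1 addrAC subrr add0r.
have QA : Q * A = Q * P by rewrite /A mulrBr mulrDr QQ mulr1 addrK.
have sA : sym_op A.
  apply/selfadjointP; rewrite /selfadjoint /A adjointB adjointD adjoint1 adjointK.
  by rewrite (addrC P).
have AA : A * A = 1 + (P - Q) * (Q - P).
  rewrite {2}/A mulrBr mulrDr AP AQ mulr1 /A.
  rewrite mulrBr !mulrBl PP QQ !opprB (addrC (Q * P)) addrCA (addrC P) opprD.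
  by rewrite (addrACA (P * Q)).
split=> //; rewrite ?AP ?QA//.
- move=> x; rewrite mul1r AA bop_addE rdotDl bop_oneE rdotxx lerDl.
  by rewrite bop_mulE adjointP adjointB adjointK rdotxx sqr_ge0.
- by rewrite mulrA PA -AQ -!mulrA QA AP.
Qed.

End SignOfIdempotent.

Theorem corollary3p10 (R : realType) (H : hilbertType R) (sepH : separable_space H)
    (P J : bop H) (idemP : is_idempotent P) (symJ : is_symmetry J) :
  Delta P J <->
  Gamma P ('i%C *: (J * (2 *: range_proj (pos_part (P + adjoint P)) - 1))).
Proof.
have [aJ JJ] := symJ.
have [] := idempotent_shift idemP.
set Q := adjoint P; set A := P + Q - 1 => sA A1 AP PAA.
have [U [sU UU UA1 twist]] := sign_exists sA A1.
have -> : P + Q = A + 1 by rewrite subrK.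
rewrite (range_proj_pos_part sA sU UU _ UA1); last by apply: twist; rewrite ?mulrA.
have aU : adjoint U = U by apply/selfadjointP.
have UPU : U * P * U = Q by rewrite (twist P Q)// -mulrA UU mulr1.
have ii : 'i%C * 'i%C = -1 :> R[i] by rewrite -expr2 sqr_i.
have aJU : adjoint ('i%C *: (J * U)) = 'i%C *: - (U * J).
  rewrite adjointZ adjointM aJ aU scalerN -scaleNr; congr (_ *: _).
  by apply/eqP; rewrite eq_complex /= oppr0 !eqxx.
have i0 : 'i%C != 0 :> R[i].
  apply/eqP => i0; move: ii; rewrite i0 mul0r => /eqP.
  by rewrite eq_sym oppr_eq0 oner_eq0.
have anti_sym : J * U = - (U * J) -> is_symmetry ('i%C *: (J * U)).
  move=> JU; split; first by rewrite /selfadjoint aJU -JU.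
  rewrite bop_scalerAl bop_scalerAr scalerA ii scaleN1r {1}JU mulNr opprK.
  by rewrite -mulrA (mulrA J) JJ mul1r UU.
(* Anticommutation turns the right factor [J * U] into [- (U * J)], so that
   [U * P * U = Q] appears in the middle. *)
have conj_adj : J * U = - (U * J) ->
    'i%C *: (J * U) * P * ('i%C *: (J * U)) = J * Q * J.
  move=> JU; rewrite !bop_scalerAl bop_scalerAr scalerA ii scaleN1r {2}JU mulrN opprK.
  by rewrite -UPU !mulrA.
have adjJ X Y : J * X * J = 1 - Y -> J * adjoint X * J = 1 - adjoint Y.
  by move=> /(congr1 (@adjoint R H)); rewrite !adjointM aJ adjointB adjoint1 mulrA.
split=> [[_ JPJ]|[[aJ' _] J'PJ']].
- have JQJ : J * Q * J = 1 - P by have := adjJ _ _ JPJ; rewrite adjointK.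
  have AJ : A * J = - J * A.
    have JAJ : J * A * J = - A.
      rewrite /A mulrBr mulr1 mulrDr mulrBl mulrDl JPJ JQJ JJ.
      by rewrite -addrA (addrAC 1 (- P)) subrr add0r opprB (addrC P) opprD addrA.
    by rewrite -[LHS]mul1r -JJ -mulrA (mulrA J A) JAJ mulrN mulNr.
  have JU : J * U = - (U * J).
    rewrite (twist J (- J))// ?mulNr ?opprK//.
    by rewrite -[RHS]mulrA AJ !mulrA mulrN AJ !mulNr opprK.
  by split; [exact: anti_sym|rewrite conj_adj].
- have JU : J * U = - (U * J).
    (* ['i J U] is self-adjoint, while its adjoint is ['i *: - (U * J)]. *)
    by apply: (scalerI i0); rewrite -aJU.
  split=> //; rewrite -{1}(adjointK P); apply: adjJ.
  by rewrite -/Q -(conj_adj JU).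
Qed.
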